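(* Suppose that $q\in\mathbb{C}$ is transcendental, and let $\mathcal{A}=\bigotimes_{i=1}^k\mathbb{C}[a_i^{\pm1},b_i]^q$ be the $\mathbb{C}$-algebra defined by the generators $a_i^{\pm1}$, $b_i$ ($i=1,\dots,k$) and by the relations that $b_ia_i=q\,a_ib_i$ for every $i$, and that $a_i,b_i$ commute with $a_j,b_j$ whenever $i\neq j$. For each $i=1,2,\dots,k$ let a triangular matrix $A_i=\begin{pmatrix} a_i & b_i\\ 0& a_i^{-1}\end{pmatrix}$ or $A_i=\begin{pmatrix} a_i & 0\\ b_i& a_i^{-1}\end{pmatrix}$ be given, and consider the positive integer $t_0=\mathrm{Trace}\,A_1^{(0)}A_2^{(0)}\cdots A_k^{(0)}$, where $A_i^{(0)}=\begin{pmatrix}1&1\\0&1\end{pmatrix}$ if $A_i=\begin{pmatrix} a_i & b_i\\ 0& a_i^{-1}\end{pmatrix}$ and $A_i^{(0)}=\begin{pmatrix}1&0\\1&1\end{pmatrix}$ if $A_i=\begin{pmatrix} a_i & 0\\ b_i& a_i^{-1}\end{pmatrix}$. Then, for every $n$, $T_n(\mathrm{Trace}\,A_1A_2\cdots A_k)$ is the sum of exactly $$T_n(t_0)=\left(\frac{t_0+\sqrt{t_0^2-4}}{2}\right)^n+\left(\frac{t_0-\sqrt{t_0^2-4}}{2}\right)^n$$ positive monomials of the form $+q^{\xi}\prod_{i=1}^k a_i^{\alpha_i}b_i^{\beta_i}$ with $\xi,\alpha_i,\beta_i\in\mathbb{Z}$ and $\beta_i\geq0$.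
   Context: Products of $2$-by-$2$ matrices over $\mathcal{A}$ are given by the usual formula, and the trace of $\begin{pmatrix} a&b\\c&d\end{pmatrix}$ is $a+d\in\mathcal{A}$. The (normalized) Chebyshev polynomials of the first kind $T_n(t)\in\mathbb{Z}[t]$, $n\ge 0$, are defined by $T_0(t)=2$, $T_1(t)=t$ and $T_{n+1}(t)=t\,T_n(t)-T_{n-1}(t)$. Every element of $\mathcal{A}$ has a unique decomposition as a $\mathbb{C}$-linear combination of the monomials $\prod_{i=1}^k a_i^{\alpha_i}b_i^{\beta_i}$ with $\alpha_i,\beta_i\in\mathbb{Z}$, $\beta_i\geq0$. The number of positive monomials in a sum is counted with repetition (the same monomial may occur several times). *)

(* Defs.v *)
(* The field of complex numbers is R[i] for R : realType. *)
From HB Require Import structures.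
From mathcomp Require Import all_boot all_order all_algebra.
From mathcomp Require Import boolp reals complex.
From mathcomp.multinomials Require Import monalg.

Set Implicit Arguments.
Unset Strict Implicit.
Unset Printing Implicit Defensive.

Import Order.TTheory GRing.Theory Num.Theory.
Local Open Scope ring_scope.
Local Open Scope quotient_scope.

Section TwoSidedIdeal.
Variables (F : nzRingType) (S : F -> Prop).

(* The two-sided ideal generated by S. *)
Inductive gen_ideal : F -> Prop :=
| GenIdeal0 : gen_ideal 0
| GenIdealD u r v x : S r -> gen_ideal x -> gen_ideal (u * r * v + x).

Lemma gen_ideal_add x y : gen_ideal x -> gen_ideal y -> gen_ideal (x + y).
Proof.
move=> Ix Iy; elim: Ix => [|u r v z Sr _ IH]; first by rewrite add0r.
by rewrite -addrA; apply: GenIdealD.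
Qed.

Lemma gen_ideal_mull c x : gen_ideal x -> gen_ideal (c * x).
Proof.
elim=> [|u r v z Sr _ IH]; first by rewrite mulr0; constructor.
by rewrite mulrDr !mulrA; apply: GenIdealD.
Qed.

Lemma gen_ideal_mulr c x : gen_ideal x -> gen_ideal (x * c).
Proof.
elim=> [|u r v z Sr _ IH]; first by rewrite mul0r; constructor.
by rewrite mulrDl -mulrA; apply: GenIdealD.
Qed.

Lemma gen_ideal_gen r : S r -> gen_ideal r.
Proof.
move=> Sr; rewrite -[r]addr0 -[r]mul1r -[1 * r]mulr1.
by apply: GenIdealD => //; constructor.
Qed.

Lemma gen_ideal_ker (T : nzRingType) (f : {rmorphism F -> T}) x :
  (forall r, S r -> f r = 0) -> gen_ideal x -> f x = 0.
Proof.
move=> fS; elim=> [|u r v y /fS r0 _ y0]; first exact: rmorph0.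
by rewrite rmorphD !rmorphM r0 y0 mulr0 mul0r addr0.
Qed.

Definition gen_ideal_pred : {pred F} := fun x => `[< gen_ideal x >].

Lemma gen_ideal_zmod_closed : zmod_closed gen_ideal_pred.
Proof.
split=> [|x y /asboolP Ix /asboolP Iy]; first by apply/asboolP; constructor.
apply/asboolP; apply: gen_ideal_add => //.
by rewrite -mulN1r; apply: gen_ideal_mull.
Qed.

HB.instance Definition _ :=
  GRing.isZmodClosed.Build F gen_ideal_pred gen_ideal_zmod_closed.

End TwoSidedIdeal.

Section PresentedAlgebra.
Variables (K : comNzRingType) (F : algType K) (S : F -> Prop).

(* The quotient of F by the two-sided ideal generated by S; it may be trivial,
   hence only a pzRingType. *)
Definition quot_alg := Quotient.quot (gen_ideal_pred S).
HB.instance Definition _ := Choice.on quot_alg.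
HB.instance Definition _ := EqQuotient.on quot_alg.
HB.instance Definition _ := GRing.Zmodule.on quot_alg.

Definition quot_proj (x : F) : quot_alg := \pi_quot_alg x.

Lemma quot_projP x y : quot_proj x = quot_proj y <-> gen_ideal S (x - y).
Proof.
rewrite /quot_proj; split=> [/eqP|Ixy].
  by rewrite -(Quotient.idealrBE (gen_ideal_pred S)) => /asboolP.
by apply/eqP; rewrite -(Quotient.idealrBE (gen_ideal_pred S)); apply/asboolP.
Qed.

Lemma quot_projK x : quot_proj (repr x) = x.
Proof. exact: reprK. Qed.

Lemma quot_projD : {morph quot_proj : x y / x + y}.
Proof. by move=> x y; rewrite /quot_proj (Quotient.pi_add (gen_ideal_pred S)). Qed.

Definition quot_one : quot_alg := lift_cst quot_alg 1.
Definition quot_mul := lift_op2 quot_alg (@GRing.mul F).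
Definition quot_scale (c : K) := lift_op1 quot_alg (fun x : F => c *: x).

Lemma repr_quot_proj x : gen_ideal S (repr (quot_proj x) - x).
Proof. by apply/quot_projP; rewrite quot_projK. Qed.

Lemma quot_oneE : quot_one = quot_proj 1.
Proof. by rewrite /quot_one; unlock. Qed.

Lemma quot_mulE x y : quot_mul (quot_proj x) (quot_proj y) = quot_proj (x * y).
Proof.
unlock quot_mul; apply/quot_projP.
have -> : repr (quot_proj x) * repr (quot_proj y) - x * y =
    (repr (quot_proj x) - x) * repr (quot_proj y)
    + x * (repr (quot_proj y) - y).
  by rewrite mulrBl mulrBr addrA subrK.
apply: gen_ideal_add; first exact/gen_ideal_mulr/repr_quot_proj.
exact/gen_ideal_mull/repr_quot_proj.
Qed.

Lemma quot_scaleE c x : quot_scale c (quot_proj x) = quot_proj (c *: x).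
Proof.
unlock quot_scale; apply/quot_projP.
by rewrite -scalerBr -mulr_algl; apply/gen_ideal_mull/repr_quot_proj.
Qed.

Lemma quot_mulA : associative quot_mul.
Proof.
move=> x y z; rewrite -[x]quot_projK -[y]quot_projK -[z]quot_projK.
by rewrite !quot_mulE mulrA.
Qed.

Lemma quot_mul1r : left_id quot_one quot_mul.
Proof. by move=> x; rewrite -[x]quot_projK quot_oneE quot_mulE mul1r. Qed.

Lemma quot_mulr1 : right_id quot_one quot_mul.
Proof. by move=> x; rewrite -[x]quot_projK quot_oneE quot_mulE mulr1. Qed.

Lemma quot_mulDl : left_distributive quot_mul +%R.
Proof.
move=> x y z; rewrite -[x]quot_projK -[y]quot_projK -[z]quot_projK.
by rewrite -quot_projD !quot_mulE mulrDl quot_projD.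
Qed.

Lemma quot_mulDr : right_distributive quot_mul +%R.
Proof.
move=> x y z; rewrite -[x]quot_projK -[y]quot_projK -[z]quot_projK.
by rewrite -quot_projD !quot_mulE mulrDr quot_projD.
Qed.

HB.instance Definition _ := GRing.Zmodule_isPzRing.Build quot_alg
  quot_mulA quot_mul1r quot_mulr1 quot_mulDl quot_mulDr.

Lemma quot_scaleA c d x : quot_scale c (quot_scale d x) = quot_scale (c * d) x.
Proof. by rewrite -[x]quot_projK !quot_scaleE scalerA. Qed.

Lemma quot_scale1 : left_id 1 quot_scale.
Proof. by move=> x; rewrite -[x]quot_projK quot_scaleE scale1r. Qed.

Lemma quot_scaleDr : right_distributive quot_scale +%R.
Proof.
move=> c x y; rewrite -[x]quot_projK -[y]quot_projK.
by rewrite -quot_projD !quot_scaleE scalerDr quot_projD.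
Qed.

Lemma quot_scaleDl x : {morph quot_scale^~ x : c d / c + d}.
Proof.
by move=> c d /=; rewrite -[x]quot_projK !quot_scaleE -quot_projD scalerDl.
Qed.

HB.instance Definition _ := GRing.Zmodule_isLmodule.Build K quot_alg
  quot_scaleA quot_scale1 quot_scaleDr quot_scaleDl.

Lemma quot_proj0 : quot_proj 0 = 0.
Proof. by apply: (addIr (quot_proj 0)); rewrite -quot_projD !add0r. Qed.

Lemma quot_projM : {morph quot_proj : x y / x * y}.
Proof. by move=> x y; rewrite -quot_mulE. Qed.

Lemma quot_proj1 : quot_proj 1 = 1.
Proof. by rewrite -quot_oneE. Qed.

Lemma quot_projZ c : {morph quot_proj : x / c *: x}.
Proof. by move=> x; rewrite -quot_scaleE. Qed.

Lemma quot_scaleAl (c : K) (x y : quot_alg) : c *: (x * y) = (c *: x) * y.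
Proof.
rewrite -[x]quot_projK -[y]quot_projK.
by rewrite -quot_projM -!quot_projZ -quot_projM scalerAl.
Qed.

Lemma quot_scaleAr (c : K) (x y : quot_alg) : c *: (x * y) = x * (c *: y).
Proof.
rewrite -[x]quot_projK -[y]quot_projK.
by rewrite -quot_projM -!quot_projZ -quot_projM scalerAr.
Qed.

Lemma quot_proj_gen x y : S (x - y) -> quot_proj x = quot_proj y.
Proof. by move=> Sxy; apply/quot_projP/gen_ideal_gen. Qed.

Lemma quot_alg_neq0 (T : nzRingType) (f : {rmorphism F -> T}) :
  (forall r, S r -> f r = 0) -> (1 : quot_alg) != 0.
Proof.
move=> fS; apply/eqP; rewrite -quot_proj0 -quot_proj1 => /quot_projP.
by move=> /(gen_ideal_ker fS)/eqP; rewrite subr0 rmorph1 oner_eq0.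
Qed.

End PresentedAlgebra.

Section ScalarMorphism.
Variables (K : comNzRingType) (F : algType K) (f : {rmorphism F -> K}).

Lemma rmorph_comm0 x y : f (x * y - y * x) = 0.
Proof. by rewrite rmorphB 2!rmorphM mulrC subrr. Qed.

Lemma rmorph_inv0 x y : f x = 1 -> f y = 1 -> f (x * y - 1) = 0.
Proof. by move=> x1 y1; rewrite rmorphB rmorphM rmorph1 x1 y1 mulr1 subrr. Qed.

Lemma rmorph_qcomm0 c x y : f y = 0 -> f (y * x - c *: (x * y)) = 0.
Proof.
by move=> y0; rewrite rmorphB -mulr_algl 3!rmorphM y0 mul0r 2!mulr0 subrr.
Qed.

End ScalarMorphism.

Section FreeAlgebra.
Variables (K : comNzRingType) (I : choiceType).

(* The free associative unital K-algebra on I. *)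
Definition freealg := {malg K[{fmonom I}]}.
HB.instance Definition _ := GRing.Lalgebra.on freealg.

Lemma freealg_scaleAr (c : K) (x y : freealg) : c *: (x * y) = x * (c *: y).
Proof.
have comc (z : {malg K[{fmonom I}]}) : z * c%:MP = c%:MP * z.
  rewrite [RHS]malgM_def [LHS]malgM_def fgmulUg fgmulgU.
  by apply: eq_bigr => m _; rewrite mul1m mulm1 mulrC.
by rewrite -2!mul_malgC 2!mulrA comc.
Qed.

HB.instance Definition _ :=
  GRing.Lalgebra_isAlgebra.Build K freealg freealg_scaleAr.

Definition fgen (i : I) : freealg := << fmu i >>.

Section Eval.
Variable f : I -> K.

Definition fmonom_eval (m : {fmonom I}) : K := \prod_(i <- (m : seq I)) f i.

Lemma fmonom_eval_mmorphism : mmorphism fmonom_eval.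
Proof.
by split=> [x y|]; rewrite /fmonom_eval ?fmM ?big_cat // fm1 big_nil.
Qed.
HB.instance Definition _ :=
  isMultiplicative.Build _ _ fmonom_eval fmonom_eval_mmorphism.

Definition feval (x : freealg) : K := mmap idfun fmonom_eval x.
HB.instance Definition _ := GRing.isZmodMorphism.Build freealg K feval
  (mmap_is_additive (f := idfun) (h := fmonom_eval)).
HB.instance Definition _ := GRing.isMonoidMorphism.Build freealg K feval
  ((mmap_is_multiplicative (f := idfun) (h := fmonom_eval)).2,
   (mmap_is_multiplicative (f := idfun) (h := fmonom_eval)).1).

Lemma feval_gen i : feval (fgen i) = f i.
Proof.
by rewrite /feval /fgen mmapU mul1r /= /fmonom_eval fmU big_seq1.
Qed.

End Eval.
End FreeAlgebra.

Section QuantumAlgebra.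
Variables (K : fieldType) (q : K) (k : nat).

(* Formal letters for a_i, a_i^-1 and b_i, in this order. *)
Definition letter : choiceType := ('I_k + 'I_k + 'I_k)%type.

Definition fa (i : 'I_k) : freealg K letter := fgen K (inl (inl i)).
Definition faV (i : 'I_k) : freealg K letter := fgen K (inl (inr i)).
Definition fb (i : 'I_k) : freealg K letter := fgen K (inr i).

(* Each relator r stands for the relation r = 0.  Commutation of a_i^-1 with
   a_j, a_j^-1 and b_j, j != i, follows from these. *)
Inductive relator : freealg K letter -> Prop :=
| rel_aaV i : relator (fa i * faV i - 1)
| rel_aVa i : relator (faV i * fa i - 1)
| rel_ba i : relator (fb i * fa i - q *: (fa i * fb i))
| rel_aaC i j : i != j -> relator (fa i * fa j - fa j * fa i)
| rel_abC i j : i != j -> relator (fa i * fb j - fb j * fa i)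
| rel_bbC i j : i != j -> relator (fb i * fb j - fb j * fb i).

(* The augmentation a_i |-> 1, b_i |-> 0, which shows that qalg is nonzero. *)
Definition aug : {rmorphism freealg K letter -> K} :=
  feval (fun l : letter => if l is inl _ then 1 else 0).

Lemma aug_relator r : relator r -> aug r = 0.
Proof.
case=> [i|i|i|i j _|i j _|i j _].
- by apply: rmorph_inv0; apply: feval_gen.
- by apply: rmorph_inv0; apply: feval_gen.
- by apply: rmorph_qcomm0; apply: feval_gen.
- exact: rmorph_comm0.
- exact: rmorph_comm0.
- exact: rmorph_comm0.
Qed.

Definition qalg := quot_alg relator.
HB.instance Definition _ := Choice.on qalg.
HB.instance Definition _ := GRing.PzRing.on qalg.
HB.instance Definition _ :=
  GRing.PzSemiRing_isNonZero.Build qalg (quot_alg_neq0 aug_relator).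
HB.instance Definition _ := GRing.Lmodule.on qalg.
HB.instance Definition _ :=
  GRing.Lmodule_isLalgebra.Build K qalg (@quot_scaleAl _ _ relator).
HB.instance Definition _ :=
  GRing.Lalgebra_isAlgebra.Build K qalg (@quot_scaleAr _ _ relator).

Definition ga (i : 'I_k) : qalg := quot_proj relator (fa i).
Definition gaV (i : 'I_k) : qalg := quot_proj relator (faV i).
Definition gb (i : 'I_k) : qalg := quot_proj relator (fb i).

Lemma ga_gaV i : ga i * gaV i = 1.
Proof.
rewrite -[LHS]quot_projM -[RHS]quot_proj1.
exact/quot_proj_gen/rel_aaV.
Qed.

Lemma gaV_ga i : gaV i * ga i = 1.
Proof.
rewrite -[LHS]quot_projM -[RHS]quot_proj1.
exact/quot_proj_gen/rel_aVa.
Qed.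

Lemma gb_ga i : gb i * ga i = q *: (ga i * gb i).
Proof.
rewrite -[LHS]quot_projM -[ga i * _]quot_projM -[RHS]quot_projZ.
exact/quot_proj_gen/rel_ba.
Qed.

Lemma ga_gaC i j : i != j -> ga i * ga j = ga j * ga i.
Proof.
move=> ij; rewrite -[LHS]quot_projM -[RHS]quot_projM.
exact/quot_proj_gen/rel_aaC.
Qed.

Lemma ga_gbC i j : i != j -> ga i * gb j = gb j * ga i.
Proof.
move=> ij; rewrite -[LHS]quot_projM -[RHS]quot_projM.
exact/quot_proj_gen/rel_abC.
Qed.

Lemma gb_gbC i j : i != j -> gb i * gb j = gb j * gb i.
Proof.
move=> ij; rewrite -[LHS]quot_projM -[RHS]quot_projM.
exact/quot_proj_gen/rel_bbC.
Qed.

Definition ga_exp (i : 'I_k) (z : int) : qalg :=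
  match z with Posz m => ga i ^+ m | Negz m => gaV i ^+ m.+1 end.

(* The exponents of q^xi * \prod_i a_i^(alpha i) * b_i^(beta i). *)
Record qmonom := QMonom {
  qm_xi : int;
  qm_alpha : 'I_k -> int;
  qm_beta : 'I_k -> nat
}.

Definition qmonom_val (m : qmonom) : qalg :=
  (q ^ qm_xi m) *: \prod_(i < k) (ga_exp i (qm_alpha m i) * gb i ^+ qm_beta m i).

(* x is a sum of positive monomials, counted with repetition, and N is the
   number of terms of any such sum. *)
Definition sum_of_exactly (N : int) (x : qalg) : Prop :=
  (exists s : seq qmonom,
     (size s)%:Z = N /\ x = \sum_(m <- s) qmonom_val m) /\
  (forall s : seq qmonom,
     x = \sum_(m <- s) qmonom_val m -> (size s)%:Z = N).

End QuantumAlgebra.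

Definition mx2 (S : Type) (a b c d : S) : 'M[S]_2 :=
  \matrix_(i, j) if i == 0 then (if j == 0 then a else b)
                 else (if j == 0 then c else d).

Definition Amx (K : fieldType) (q : K) (k : nat) (upper : 'I_k -> bool)
    (i : 'I_k) : 'M[qalg q k]_2 :=
  if upper i then mx2 (ga q i) (gb q i) 0 (gaV q i)
  else mx2 (ga q i) 0 (gb q i) (gaV q i).

Definition A0mx (k : nat) (upper : 'I_k -> bool) (i : 'I_k) : 'M[int]_2 :=
  if upper i then mx2 1 1 0 1 else mx2 1 0 1 1.

Fixpoint chebT (n : nat) : {poly int} :=
  if n is m.+1 then
    if m is p.+1 then 'X * chebT m - chebT p else 'X
  else 2%:R.

(* The value at an element of a possibly noncommutative ring. *)
Definition cheb_eval (A : nzRingType) (n : nat) (x : A) : A :=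
  (map_poly (intr : int -> A) (chebT n)).[x].

Definition transcendental (R : realType) (q : R[i]) : Prop :=
  ~ algebraicOver (ratr : rat -> R[i]) q.

(* Main.v *)
(* Write M = A_1 ... A_k = (a, b; c, d).  Each A_i satisfies the quantum SL_2
   condition M^T E M = E with E = (0, 1; - q^-1, 0), and this condition is
   stable under products of matrices with mutually commuting entries, hence
   holds for M.  Then x = a X + b Y and y = c X + d Y satisfy y x = q x y
   whenever Y X = q X Y.  Let G(j, m) be the coefficient of X^j Y^m in x^j y^m.
   The condition on M gives
     G(j+1, m+1) = a G(j, m+1) + d G(j+1, m) - G(j, m),
   so that S_n = \sum_(j+m=n) G(j, m) satisfies S_(n+2) = (a + d) S_(n+1) - S_n;
   thus S_n is the Chebyshev polynomial of the second kind at a + d, and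
   T_(n+2)(a + d) = S_(n+2) - S_n.  It also shows that each difference
   G(j+1, m+1) - G(j, m) is a sum of products of a, b, c, d and powers of q,
   so T_n(a + d) is positive.  The computation takes place in qalg * int, with
   (A_i, A_i^(0)) in place of A_i and (q, 1) in place of q, so that the second
   component counts monomials.

   The number of terms is unique because the algebra acts on functions on Z^k
   by (a_i f)(p) = f(p + e_i) and (b_i f)(p) = q^(- p_i) f(p): applying a
   monomial to the constant function 1 and evaluating at 0 gives a power of q,
   and for q transcendental an equality between two sums of powers of q forces
   both sums to have the same number of terms. *)
Require Import Defs.
From HB Require Import structures.
From mathcomp Require Import all_boot all_order all_algebra.
From mathcomp Require Import zify ring.
From mathcomp Require Import boolp reals complex.
From mathcomp.multinomials Require Import monalg.

Set Implicit Arguments.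
Unset Strict Implicit.
Unset Printing Implicit Defensive.

Import Order.TTheory GRing.Theory Num.Theory.
Local Open Scope ring_scope.

(** * Traces of symmetric powers of a quantum SL_2 matrix *)

Section QuantumTrace.
Variables (B : nzRingType) (u v a b c d : B).
Hypotheses (uC : forall x, u * x = x * u) (uv1 : u * v = 1).
Hypotheses (caE : c * a = u * (a * c)) (dbE : d * b = u * (b * d)).
Hypotheses (adE : a * d = 1 + v * (c * b)) (daE : d * a = 1 + u * (b * c)).

Let uX_CA n x y : x * (u ^+ n * y) = u ^+ n * (x * y).
Proof.
elim: n => [|n IH]; first by rewrite !mul1r.
by rewrite exprS -[u * _ * y]mulrA mulrA -uC -mulrA IH !mulrA.
Qed.

Let u_CA x y : x * (u * y) = u * (x * y).
Proof. exact: (uX_CA 1). Qed.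

Let uK x : u * (v * x) = x.
Proof. by rewrite mulrA uv1 mul1r. Qed.

Let vK x : v * (u * x) = x.
Proof. by rewrite u_CA uK. Qed.

Definition shift (f : nat -> B) l := if l is l'.+1 then f l' else 0.

(* A sequence f stands for the polynomial \sum_l f l X^l Y^(n-l) in two
   variables with Y X = u X Y; the two operators are the left multiplications
   by a X + b Y and c X + d Y. *)
Definition mulX f l := a * shift f l + u ^+ l * (b * f l).
Definition mulY f l := c * shift f l + u ^+ l * (d * f l).

(** The relation Y X = u X Y passes to x = a X + b Y and y = c X + d Y: in the mixed term, the
    summands 1 of [daE] and [adE] contribute equally to both sides. *)
Lemma mulYX f l : mulY (mulX f) l = u * mulX (mulY f) l.
Proof.
rewrite /mulX /mulY; case: l => [|l] /=.
  by rewrite !mulr0 !add0r !mul1r mulrA dbE !mulrA.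
set s := shift f l.
rewrite !mulrDr !uX_CA.
have -> : c * (a * s) = u * (a * (c * s)) by rewrite mulrA caE !mulrA.
have -> : d * (b * f l.+1) = u * (b * (d * f l.+1)) by rewrite mulrA dbE !mulrA.
have -> : d * (a * f l) = f l + u * (b * (c * f l)).
  by rewrite mulrA daE mulrDl mul1r !mulrA.
have -> : a * (d * f l) = f l + v * (c * (b * f l)).
  by rewrite mulrA adE mulrDl mul1r !mulrA.
rewrite -!addrA; congr (_ + _); rewrite !addrA; congr (_ + _).
by rewrite !mulrDr uK !addrA exprSr -!mulrA [X in X + _]addrC.
Qed.

Lemma mulX_scale f g k : (forall l, f l = u ^+ k * g l) ->
  forall l, mulX f l = u ^+ k * mulX g l.
Proof.
move=> fg l; rewrite /mulX mulrDr; congr (_ + _).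
  by case: l => [|l] /=; rewrite ?mulr0 // fg uX_CA.
by rewrite fg [b * _]uX_CA [LHS]uX_CA.
Qed.

(** As operators, a y = Y + v c x; left multiplication by Y scales the coefficient of index l by
    [u ^+ l]. *)
Lemma mulX_mulY f l : a * mulY f l = u ^+ l * f l + v * (c * mulX f l).
Proof.
rewrite /mulX /mulY !mulrDr !uX_CA.
rewrite !(mulrA c a) caE !(mulrA a d) adE mulrDl mul1r !mulrDr.
by rewrite -!mulrA vK addrCA -uX_CA.
Qed.

(** As operators, d x = X + u b y; left multiplication by X is [shift]. *)
Lemma mulY_mulX f l : d * mulX f l = shift f l + u * (b * mulY f l).
Proof.
rewrite /mulX /mulY !mulrDr !uX_CA.
rewrite !(mulrA d a) daE !(mulrA d b) dbE mulrDl mul1r.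
by rewrite -!mulrA -!addrA.
Qed.

(* qmonX j m l is the coefficient of X^l Y^(j+m-l) in
   (a X + b Y)^j (c X + d Y)^m. *)
Definition qmonX j m : nat -> B :=
  iter j mulX (iter m mulY (fun l => (l == 0)%:R)).

(** Moving y to the right past each of the j factors x costs one factor u. *)
Lemma mulY_qmonX j m l : mulY (qmonX j m) l = u ^+ j * qmonX j m.+1 l.
Proof.
elim: j l => [|j IH] l; first by rewrite mul1r.
by rewrite mulYX (mulX_scale IH) mulrA -exprS.
Qed.

Lemma qmonX_eq0 j l : (j < l)%N -> qmonX j 0 l = 0.
Proof.
elim: j l => [|j IH] [|l] // jl.
rewrite -[LHS]/(a * qmonX j 0 l + u ^+ l.+1 * (b * qmonX j 0 l.+1)).
by rewrite !IH ?mulr0 ?addr0 // ltnW.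
Qed.

Definition qdiag j m := qmonX j m j.

Lemma qdiag0m m : qdiag 0 m = d ^+ m.
Proof.
elim: m => [|m IH] //.
by rewrite /qdiag /qmonX /= /mulY /= mulr0 add0r mul1r exprS -IH.
Qed.

Lemma qdiagS0 j : qdiag j.+1 0 = a * qdiag j 0.
Proof.
by rewrite /qdiag /qmonX /= /mulX /= [X in b * X]qmonX_eq0 // !mulr0 addr0.
Qed.

Lemma qdiagj0 j : qdiag j 0 = a ^+ j.
Proof. by elim: j => // j IH; rewrite qdiagS0 IH exprS. Qed.

Lemma qmonXSS j m l :
  qmonX j.+1 m l.+1 = a * qmonX j m l + u ^+ l.+1 * (b * qmonX j m l.+1).
Proof. by []. Qed.

(** The term in b produced by the leading factor x is eliminated through d x = X + u b y, applied to
    x^j y^m. *)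
Lemma qdiagSS j m :
  qdiag j.+1 m.+1 = a * qdiag j m.+1 + d * qdiag j.+1 m - qdiag j m.
Proof.
rewrite /qdiag qmonXSS -addrA; congr (_ + _).
rewrite -[X in d * X]/(mulX (qmonX j m) j.+1) mulY_mulX.
rewrite [shift _ _ + _]addrC -[shift _ _]/(qmonX j m j) addrK.
by rewrite mulY_qmonX uX_CA [RHS]mulrA -exprS.
Qed.

(** Here the term in a is expanded by a y = Y + v c x, so that no subtraction remains. *)
Lemma qdiagSS_pos j m : qdiag j.+1 m.+1 = qdiag j m
  + v ^+ j.+1 * (c * qmonX j.+1 m j) + u ^+ j.+1 * (b * qmonX j m.+1 j.+1).
Proof.
rewrite /qdiag qmonXSS; congr (_ + _).
have vuX n x : v ^+ n * (u ^+ n * x) = x.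
  elim: n x => [|n IH] x; first by rewrite !mul1r.
  by rewrite exprSr exprS -!mulrA vK IH.
(* The inserted factor [u ^+ j] turns x^j y^(m+1) into y x^j y^m. *)
rewrite -[LHS](vuX j) -uX_CA -mulY_qmonX mulX_mulY mulrDr vuX.
by rewrite exprSr -!mulrA.
Qed.

(* The trace of the n-th symmetric power of the matrix (a, b; c, d). *)
Definition symtr n := \sum_(j < n.+1) qdiag j (n - j).

Lemma symtr0 : symtr 0 = 1.
Proof. by rewrite /symtr big_ord1. Qed.

Lemma symtr1 : symtr 1 = a + d.
Proof. by rewrite /symtr big_ord_recr big_ord1 /= addrC qdiag0m qdiagj0. Qed.

(** Once the terms j = 0 and j = n + 2 are split off, both indices are positive and the sum runs
    parallel to [symtr n]. *)
Lemma symtr_split n : symtr n.+2 =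
  d ^+ n.+2 + (\sum_(j < n.+1) qdiag j.+1 (n - j).+1 + a ^+ n.+2).
Proof.
rewrite /symtr big_ord_recl big_ord_recr /= subnn qdiagj0 qdiag0m.
congr (_ + (_ + _)).
by apply: eq_bigr => j _; rewrite /bump /= add1n subSS subSn // -ltnS.
Qed.

(** Summing [qdiagSS] over the inner terms misses only a^(n+2) in a S_(n+1) and d^(n+2) in d
    S_(n+1), which are the extreme terms of S_(n+2). *)
Lemma symtrSS n : symtr n.+2 = (a + d) * symtr n.+1 - symtr n.
Proof.
have aS : a * symtr n.+1 = \sum_(j < n.+1) a * qdiag j (n - j).+1 + a ^+ n.+2.
  rewrite /symtr big_ord_recr mulrDr mulr_sumr subnn qdiagj0 -exprS.
  congr (_ + _); apply: eq_bigr => j _; congr (a * qdiag _ _).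
  by rewrite /= subSn // -ltnS.
have dS : d * symtr n.+1 = d ^+ n.+2 + \sum_(j < n.+1) d * qdiag j.+1 (n - j).
  rewrite /symtr big_ord_recl mulrDr mulr_sumr subn0 qdiag0m -exprS.
  by [].
rewrite symtr_split (eq_bigr _ (fun (j : 'I__) _ => qdiagSS j (n - j))).
rewrite !big_split /= sumrN mulrDl aS dS.
set s1 := \sum_(_ < _) a * _; set s2 := \sum_(_ < _) d * _.
rewrite (addrAC (s1 + s2)) addrA; congr (_ - _).
by rewrite [RHS]addrCA; congr (_ + _); rewrite addrAC.
Qed.

End QuantumTrace.

(** * Chebyshev polynomials and quantum SL_2 matrices *)

Section Chebyshev.
Variable B : nzRingType.
Implicit Type x : B.

Lemma cheb_eval0 x : cheb_eval 0 x = 1 + 1.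
Proof. by rewrite /cheb_eval rmorph_nat -polyC_natr hornerC. Qed.

Lemma cheb_eval1 x : cheb_eval 1 x = x.
Proof. by rewrite /cheb_eval map_polyX hornerX. Qed.

Lemma cheb_evalSSr n x :
  cheb_eval n.+2 x = cheb_eval n.+1 x * x - cheb_eval n x.
Proof.
rewrite /cheb_eval [chebT _]/('X * chebT n.+1 - chebT n) mulrC.
by rewrite rmorphB rmorphM /= map_polyX hornerD hornerN hornerMX.
Qed.

(** Evaluation puts the argument on the right, whereas [symtrSS] has a + d on the left. *)
Lemma cheb_eval_comm n x : GRing.comm x (cheb_eval n x).
Proof.
suff [] : GRing.comm x (cheb_eval n x) /\ GRing.comm x (cheb_eval n.+1 x) by [].
elim: n => [|n [IH0 IH1]].
  rewrite cheb_eval0 cheb_eval1; split=> //.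
  by apply: commrD; apply: commr1.
by split=> //; rewrite cheb_evalSSr; apply: commrB => //; apply: commrM.
Qed.

Lemma cheb_evalSS n x :
  cheb_eval n.+2 x = x * cheb_eval n.+1 x - cheb_eval n x.
Proof. by rewrite cheb_evalSSr cheb_eval_comm. Qed.

End Chebyshev.

Lemma cheb_eval_morph (B C : nzRingType) (f : {rmorphism B -> C}) n (x : B) :
  f (cheb_eval n x) = cheb_eval n (f x).
Proof.
suff [] : f (cheb_eval n x) = cheb_eval n (f x) /\
  f (cheb_eval n.+1 x) = cheb_eval n.+1 (f x) by [].
elim: n => [|n [IH0 IH1]].
  by rewrite !cheb_eval0 !cheb_eval1 rmorphD rmorph1.
by split=> //; rewrite cheb_evalSS rmorphB rmorphM /= IH0 IH1 -cheb_evalSS.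
Qed.

Lemma cheb_evalE n (x : int) : cheb_eval n x = (chebT n).[x].
Proof.
rewrite /cheb_eval; congr (_.[x]).
by rewrite map_poly_id // => i _; rewrite /= intz.
Qed.

(** * Quantum SL_2 matrices and positivity of T_n at their trace *)

Section QuantumSL2.
Variables (B : nzRingType) (u v : B).
Hypotheses (uC : forall x, u * x = x * u) (uv1 : u * v = 1).

Let vC x : v * x = x * v.
Proof.
rewrite -[LHS]mulr1 -uv1 mulrA -[v * x * u]mulrA -(uC x) mulrA.
by rewrite -(uC v) uv1 mul1r.
Qed.

Definition qform : 'M[B]_2 := mx2 0 1 (- v) 0.

(** With v = 1 and commuting entries this says that det M = 1. *)
Definition qsl2 (M : 'M[B]_2) := M^T *m qform *m M = qform.

Lemma qsl2_entry (M : 'M[B]_2) i j :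
  (M^T *m qform *m M) i j = M 0 i * M 1 j - v * (M 1 i * M 0 j).
Proof.
rewrite !mxE !big_ord_recl !big_ord0 !mxE !big_ord_recl !big_ord0 !mxE /=.
have -> : lift ord0 ord0 = 1 :> 'I_2 by apply: val_inj.
by rewrite !mulr0 !mulr1 !addr0 add0r addrC mulrN mulNr -vC mulrA.
Qed.

(** The relations are the entries (0, 0), (1, 1), (0, 1) and (1, 0) of the matrix equation, all but
    (0, 1) multiplied by u. *)
Lemma qsl2P (M : 'M[B]_2) : qsl2 M <->
  [/\ M 1 0 * M 0 0 = u * (M 0 0 * M 1 0), M 1 1 * M 0 1 = u * (M 0 1 * M 1 1),
      M 0 0 * M 1 1 = 1 + v * (M 1 0 * M 0 1)
    & M 1 1 * M 0 0 = 1 + u * (M 0 1 * M 1 0)].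
Proof.
have uK x : u * (v * x) = x by rewrite mulrA uv1 mul1r.
split=> [qM|[E1 E2 E3 E4]].
  have qME i j : M 0 i * M 1 j - v * (M 1 i * M 0 j) = qform i j.
    by rewrite -qsl2_entry qM.
  split.
  - by move: (qME 0 0); rewrite !mxE /= => /subr0_eq ->; rewrite uK.
  - by move: (qME 1 1); rewrite !mxE /= => /subr0_eq ->; rewrite uK.
  - by move: (qME 0 1); rewrite !mxE /= => <-; rewrite subrK.
  - move: (qME 1 0); rewrite !mxE /= => /(canRL (subrK _)) ->.
    by rewrite mulrDr mulrN uv1 uK addrA subrr add0r.
apply/matrixP => i j; rewrite qsl2_entry !mxE.
have vuK x : v * (u * x) = x by rewrite vC -mulrA -vC uK.
have ord2 (l : 'I_2) : l = 0 \/ l = 1.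
  by case: l => [[|[|//]] ?]; [left|right]; apply: val_inj.
by case: (ord2 i) => ->; case: (ord2 j) => -> /=;
  rewrite ?E1 ?E2 ?E3 ?E4 ?vuK ?subrr ?addrK // mulrDr vuK mulr1 opprD;
  rewrite addrCA subrr addr0.
Qed.

Definition mxcomm (M N : 'M[B]_2) := forall i j k l, GRing.comm (M i j) (N k l).

Lemma mxcomm1 M : mxcomm M 1.
Proof. by move=> i j k l; rewrite !mxE; apply: commr_nat. Qed.

Lemma mxcommM M N1 N2 : mxcomm M N1 -> mxcomm M N2 -> mxcomm M (N1 * N2).
Proof.
move=> c1 c2 i j k l; rewrite mxE; apply: commr_sum => m _.
exact: commrM.
Qed.

(** As the entries of M commute with those of N, transposition reverses the product, and M^T E M = E
    collapses inside N^T and N. *)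
Lemma qsl2_mul M N : mxcomm M N -> qsl2 M -> qsl2 N -> qsl2 (M * N).
Proof.
move=> cMN qM qN; rewrite /qsl2 -[M * N]/(M *m N).
have -> : (M *m N)^T = N^T *m M^T.
  apply/matrixP => i j; rewrite !mxE; apply: eq_bigr => l _.
  by rewrite !mxE cMN.
by rewrite -!mulmxA (mulmxA qform) (mulmxA M^T) (mulmxA M^T) qM mulmxA qN.
Qed.

Lemma qsl2_prod (I : eqType) (A : I -> 'M[B]_2) (r : seq I) :
  (forall i j, i != j -> mxcomm (A i) (A j)) -> (forall i, qsl2 (A i)) ->
  uniq r -> qsl2 (\prod_(i <- r) A i).
Proof.
move=> cA qA; elim: r => [|i r IH] /=.
  by rewrite big_nil /qsl2 trmx1 mul1mx mulmx1.
case/andP=> ir ur; rewrite big_cons; apply: qsl2_mul (IH ur) => //.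
rewrite big_seq; elim/big_rec: _ => [|j M jr cM]; first exact: mxcomm1.
by apply: mxcommM => //; apply: cA; apply: contraNneq ir => ->.
Qed.

(** [P] abstracts positivity: it is stable under sums and products, but differences must be
    cancelled beforehand. *)
Variable P : B -> Prop.
Hypotheses (P0 : P 0) (P1 : P 1) (PD : forall x y, P x -> P y -> P (x + y)).
Hypotheses (PM : forall x y, P x -> P y -> P (x * y)) (Pu : P u) (Pv : P v).

Let PX x n : P x -> P (x ^+ n).
Proof. by move=> Px; elim: n => [|n IH] //; rewrite exprS; apply: PM. Qed.

Let Psum (I : Type) (r : seq I) (F : I -> B) :
  (forall i, P (F i)) -> P (\sum_(i <- r) F i).
Proof. by move=> PF; apply: big_ind. Qed.

(** Both sides obey the Chebyshev recurrence, so induction on two consecutive indices reduces this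
    to T_2 and T_3. *)
Lemma cheb_eval_symtr a b c d n :
  c * a = u * (a * c) -> d * b = u * (b * d) ->
  a * d = 1 + v * (c * b) -> d * a = 1 + u * (b * c) ->
  cheb_eval n.+2 (a + d) = symtr u a b c d n.+2 - symtr u a b c d n.
Proof.
move=> E1 E2 E3 E4; set S := symtr u a b c d.
have S2 m : S m.+2 = (a + d) * S m.+1 - S m by apply: (symtrSS uC uv1).
have S0 : S 0 = 1 by apply: symtr0.
have S1 : S 1 = a + d by apply: symtr1.
suff [] : cheb_eval n.+2 (a + d) = S n.+2 - S n /\
  cheb_eval n.+3 (a + d) = S n.+3 - S n.+1 by [].
elim: n => [|n [IH0 IH1]].
  have e2 : cheb_eval 2 (a + d) = S 2 - S 0.
    by rewrite cheb_evalSS cheb_eval1 cheb_eval0 S2 S1 S0 opprD addrA.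
  split=> //; rewrite cheb_evalSS e2 cheb_eval1 (S2 1) S1 S0 mulrBr mulr1.
  by rewrite -!addrA.
split=> //; rewrite cheb_evalSS IH0 IH1 (S2 n.+2) [X in _ = _ - X](S2 n).
rewrite mulrBr !opprB.
by rewrite [LHS]addrACA [RHS]addrACA [in RHS](addrC (- S n.+2)).
Qed.

Lemma cheb_eval_pos a b c d n :
  c * a = u * (a * c) -> d * b = u * (b * d) ->
  a * d = 1 + v * (c * b) -> d * a = 1 + u * (b * c) ->
  P a -> P b -> P c -> P d -> P (cheb_eval n (a + d)).
Proof.
move=> E1 E2 E3 E4 Pa Pb Pc Pd; case: n => [|[|n]].
- by rewrite cheb_eval0; apply: PD.
- by rewrite cheb_eval1; apply: PD.
rewrite (cheb_eval_symtr _ E1 E2 E3 E4) symtr_split.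
have Pq j m l : P (qmonX u a b c d j m l).
  (* This is the common shape of [mulX] and [mulY]. *)
  have PmX f x y : P x -> P y -> (forall i, P (f i)) ->
      forall i, P (x * shift f i + u ^+ i * (y * f i)).
    move=> Px Py Pf i; apply: PD.
      by apply: PM => //; case: i.
    by apply: PM; [apply: PX | apply: PM].
  elim: j l => [|j IH] l /=; last exact: PmX.
  elim: m l => [|m IH] l /=; last exact: PmX.
  by case: eqP.
(* [D j] is the excess G(j+1, n-j+1) - G(j, n-j), written without subtraction. *)
pose D (j : 'I_n.+1) := v ^+ j.+1 * (c * qmonX u a b c d j.+1 (n - j) j)
  + u ^+ j.+1 * (b * qmonX u a b c d j (n - j).+1 j.+1).
have -> : \sum_(j < n.+1) qdiag u a b c d j.+1 (n - j).+1 =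
    symtr u a b c d n + \sum_(j < n.+1) D j.
  rewrite -big_split; apply: eq_bigr => j _.
  by rewrite (qdiagSS_pos uC uv1) // -addrA.
(* Cancelling [symtr n] leaves d^(n+2), a^(n+2) and the sum of the [D j]. *)
rewrite -[X in _ + X - _]addrA [X in X - _]addrCA [X in P X]addrC addKr.
apply: (PD (PX _ Pd)); apply: PD (PX _ Pa); apply: Psum => j.
by apply: PD; apply: PM; try apply: PM; try exact: PX.
Qed.

Lemma mxtrace2 (M : 'M[B]_2) : \tr M = M 0 0 + M 1 1.
Proof.
rewrite /mxtrace !big_ord_recl big_ord0 addr0.
by congr (_ + M _ _); apply: val_inj.
Qed.

Lemma cheb_eval_tr_prod_pos k (A : 'I_k -> 'M[B]_2) n :
  (forall i j, i != j -> mxcomm (A i) (A j)) -> (forall i, qsl2 (A i)) ->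
  (forall i j l, P (A i j l)) ->
  P (cheb_eval n (\tr (\prod_(i < k) A i))).
Proof.
move=> cA qA PA; set M := \prod_(i < k) A i.
have qM : qsl2 M by apply: qsl2_prod => //; apply: index_enum_uniq.
have PMx j l : P (M j l).
  rewrite /M; elim/big_rec: _ j l => [|i N _ PN] j l; rewrite mxE.
    by case: (j == l).
  by apply: Psum => m; apply: PM.
have [E1 E2 E3 E4] := (qsl2P _).1 qM.
by rewrite mxtrace2; apply: cheb_eval_pos E1 E2 E3 E4 _ _ _ _.
Qed.

End QuantumSL2.

(** * Positive monomials *)

Section NoncommutativeRing.
Variable A : nzRingType.

Lemma comm_inv (x x' y : A) :
  x * x' = 1 -> x' * x = 1 -> GRing.comm y x -> GRing.comm y x'.
Proof.
move=> xx' x'x yx; rewrite /GRing.comm -[LHS]mul1r -x'x -!mulrA.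
by rewrite [x * _]mulrA -yx -mulrA xx' mulr1.
Qed.

Lemma prodM_comm (I : eqType) (r : seq I) (X Y : I -> A) :
  (forall i j, i != j -> GRing.comm (X i) (Y j)) -> uniq r ->
  (\prod_(i <- r) X i) * (\prod_(i <- r) Y i) = \prod_(i <- r) (X i * Y i).
Proof.
move=> cXY; elim: r => [|i r IH] /=; first by rewrite !big_nil mulr1.
case/andP=> ir /IH; rewrite !big_cons => <-.
rewrite -!mulrA; congr (_ * _); rewrite !mulrA; congr (_ * _).
apply: commr_sym; rewrite big_seq; apply: commr_prod => j jr.
by apply/commr_sym/cXY; apply: contraNneq ir => <-.
Qed.
End NoncommutativeRing.

Section Monomials.
Variables (K : fieldType) (q : K) (k : nat).
Hypothesis q0 : q != 0.
Local Notation A := (qalg q k).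
Implicit Types (i j : 'I_k) (x y : A) (z : int).

Lemma ga_expS i z : ga q i * ga_exp q i z = ga_exp q i (z + 1).
Proof.
case: z => [n|[|n]].
- have -> : Posz n + 1 = Posz n.+1 by lia.
  by rewrite /= -exprS.
- by rewrite /= expr1 ga_gaV.
have -> : Negz n.+1 + 1 = Negz n by lia.
by rewrite /= exprS mulrA ga_gaV mul1r.
Qed.

Lemma gaV_expS i z : gaV q i * ga_exp q i z = ga_exp q i (z - 1).
Proof.
case: z => [[|n]|n]; first by rewrite /= mulr1 expr1.
  have -> : Posz n.+1 - 1 = Posz n by lia.
  by rewrite /= exprS mulrA gaV_ga mul1r.
have -> : Negz n - 1 = Negz n.+1 by lia.
by rewrite /= -exprS.
Qed.

Lemma gb_gaV i : gb q i * gaV q i = q^-1 *: (gaV q i * gb q i).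
Proof.
apply: (canRL (scalerK q0)).
rewrite -[RHS]mulr1 -(ga_gaV q i) mulrA -(mulrA (gaV q i)) gb_ga -scalerAr.
by rewrite -scalerAl (mulrA (gaV q i)) gaV_ga mul1r.
Qed.

Lemma gb_ga_exp i z :
  gb q i * ga_exp q i z = q ^ z *: (ga_exp q i z * gb q i).
Proof.
have qcommX x y c n :
    y * x = c *: (x * y) -> y * x ^+ n = c ^+ n *: (x ^+ n * y).
  move=> yx; elim: n => [|n IH]; first by rewrite scale1r mulr1 mul1r.
  rewrite !exprS [LHS]mulrA yx -scalerAl -(mulrA x y) IH -scalerAr scalerA.
  by rewrite mulrA.
case: z => n; first exact: (qcommX _ _ q n (gb_ga q i)).
rewrite -[ga_exp q i _]/(gaV q i ^+ n.+1) (qcommX _ _ q^-1 _ (gb_gaV i)).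
by rewrite exprVn.
Qed.

(** These are the ordered monomials of the i-th tensor factor, up to a power of q. *)
Definition lmon i x := exists z e b, x = q ^ z *: (ga_exp q i e * gb q i ^+ b).

Lemma lmonZ i z x : lmon i x -> lmon i (q ^ z *: x).
Proof.
by case=> z' [e [b ->]]; exists (z + z'), e, b; rewrite scalerA expfzDr.
Qed.

Lemma lmon1 i : lmon i 1.
Proof. by exists 0, 0, 0%N; rewrite scale1r mulr1. Qed.

Lemma lmon_ga i x : lmon i x -> lmon i (ga q i * x).
Proof.
by case=> z [e [b ->]]; exists z, (e + 1), b; rewrite -scalerAr mulrA ga_expS.
Qed.

Lemma lmon_gaV i x : lmon i x -> lmon i (gaV q i * x).
Proof.
by case=> z [e [b ->]]; exists z, (e - 1), b; rewrite -scalerAr mulrA gaV_expS.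
Qed.

Lemma lmon_gb i x : lmon i x -> lmon i (gb q i * x).
Proof.
case=> z [e [b ->]]; rewrite -scalerAr; apply: lmonZ; exists e, e, b.+1.
by rewrite mulrA gb_ga_exp -scalerAl -mulrA -exprS.
Qed.

(** The left factor is, up to a power of q, a word in the generators, each of which preserves
    [lmon i] under left multiplication. *)
Lemma lmonM i x y : lmon i x -> lmon i y -> lmon i (x * y).
Proof.
case=> z [e [b ->]] my; rewrite -scalerAl -mulrA; apply: lmonZ.
have iter_mul c n w : (forall w, lmon i w -> lmon i (c * w)) ->
    lmon i w -> lmon i (c ^+ n * w).
  move=> cP mw; elim: n => [|n IH]; rewrite ?mul1r // exprS -mulrA.
  exact: cP.
have mby : lmon i (gb q i ^+ b * y) by apply: iter_mul => //; apply: lmon_gb.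
case: e => e; apply: iter_mul => //; first exact: lmon_ga.
exact: lmon_gaV.
Qed.

Lemma lmon_gen i : [/\ lmon i (ga q i), lmon i (gaV q i) & lmon i (gb q i)].
Proof.
split; rewrite -[X in lmon i X]mulr1.
- exact/lmon_ga/lmon1.
- exact/lmon_gaV/lmon1.
- exact/lmon_gb/lmon1.
Qed.

Lemma lmon_comm i j x y : i != j -> lmon i x -> lmon j y -> GRing.comm x y.
Proof.
move=> ij [z [e [b ->]]] [z' [e' [b' ->]]].
have ji : j != i by rewrite eq_sym.
have caa : GRing.comm (ga q i) (ga q j) by apply: ga_gaC.
have cab : GRing.comm (ga q i) (gb q j) by apply: ga_gbC.
have cba : GRing.comm (gb q i) (ga q j) by apply/commr_sym/ga_gbC.
have cbb : GRing.comm (gb q i) (gb q j) by apply: gb_gbC.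
have caA : GRing.comm (ga q i) (gaV q j).
  by apply: comm_inv caa; rewrite ?ga_gaV ?gaV_ga.
have cbA : GRing.comm (gb q i) (gaV q j).
  by apply: comm_inv cba; rewrite ?ga_gaV ?gaV_ga.
have symV w : GRing.comm (ga q i) w -> GRing.comm (gaV q i) w.
  move=> /commr_sym c.
  by apply/commr_sym/(comm_inv _ _ c); rewrite ?ga_gaV ?gaV_ga.
have expR w f : GRing.comm w (ga q j) -> GRing.comm w (gaV q j) ->
    GRing.comm w (ga_exp q j f).
  by move=> c1 c2; case: f => n; apply: commrX.
have expL w f : GRing.comm (ga q i) w -> GRing.comm (gaV q i) w ->
    GRing.comm (ga_exp q i f) w.
  by move=> c1 c2; case: f => n; apply/commr_sym/commrX/commr_sym.
have powL w w' n : GRing.comm w w' -> GRing.comm (w ^+ n) w'.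
  by move=> /commr_sym c; apply/commr_sym/commrX.
have c11 : GRing.comm (ga_exp q i e) (ga_exp q j e').
  exact: expL _ _ (expR _ _ caa caA) (expR _ _ (symV _ caa) (symV _ caA)).
have c12 : GRing.comm (ga_exp q i e) (gb q j ^+ b').
  exact: commrX _ (expL _ _ cab (symV _ cab)).
have c21 : GRing.comm (gb q i ^+ b) (ga_exp q j e').
  exact: powL _ _ _ (expR _ _ cba cbA).
have c22 : GRing.comm (gb q i ^+ b) (gb q j ^+ b').
  exact: powL _ _ _ (commrX _ cbb).
have c : GRing.comm (ga_exp q i e * gb q i ^+ b) (ga_exp q j e' * gb q j ^+ b').
  by apply: commrM; apply/commr_sym/commrM; apply/commr_sym.
by rewrite /GRing.comm -!scalerAl -!scalerAr c !scalerA mulrC.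
Qed.

Definition mon x := exists m : qmonom k, x = qmonom_val q m.

Lemma mon_prod (X : 'I_k -> A) :
  (forall i, lmon i (X i)) -> mon (\prod_(i < k) X i).
Proof.
move=> mX.
have /fin_all_exists [f fP] i : exists p : int * int * nat,
    X i = q ^ p.1.1 *: (ga_exp q i p.1.2 * gb q i ^+ p.2).
  by case: (mX i) => z [e [b ->]]; exists (z, e, b).
exists (QMonom (\sum_i (f i).1.1) (fun i => (f i).1.2) (fun i => (f i).2)).
rewrite (eq_bigr _ (fun i _ => fP i)).
rewrite scaler_prod -(big_morph _ (fun a b => expfzDr a b q0) (expr0z q)).
exact: erefl.
Qed.

Lemma mon_lmon i x : lmon i x -> mon x.
Proof.
move=> mx; have -> : x = \prod_(j < k) (if j == i then x else 1).
  by rewrite -big_mkcond big_pred1_eq.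
by apply: mon_prod => j; case: eqP => [->|_]; [exact: mx | exact: lmon1].
Qed.

(** Factors of different indices commute, so the product regroups index by index. *)
Lemma monM x y : mon x -> mon y -> mon (x * y).
Proof.
case=> m -> [m' ->]; rewrite /qmonom_val -scalerAl -scalerAr.
have lm (n : qmonom k) i :
    lmon i (ga_exp q i (qm_alpha n i) * gb q i ^+ qm_beta n i).
  by exists 0; do 2!eexists; rewrite scale1r.
rewrite prodM_comm ?index_enum_uniq //; last first.
  by move=> i j ij; apply: (lmon_comm ij).
have [n ->] := mon_prod (fun i => lmonM (lm m i) (lm m' i)).
exists (QMonom (qm_xi m + qm_xi m' + qm_xi n) (qm_alpha n) (qm_beta n)).
by rewrite /qmonom_val /= !scalerA !expfzDr // mulrA.
Qed.

Lemma mon_scal z : mon (q ^ z)%:A.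
Proof.
exists (QMonom z (fun=> 0) (fun=> 0%N)); rewrite /qmonom_val /=.
by rewrite big1 // => i _; rewrite mulr1.
Qed.

(** One list witnesses both components; sizes add under sums and multiply under products, as in the
    ring A * int. *)
Definition psum (p : (A * int)%type) := exists s : seq (qmonom k),
  p = (\sum_(m <- s) qmonom_val q m, (size s)%:Z).

Lemma psum0 : psum 0.
Proof. by exists [::]; rewrite big_nil. Qed.

Lemma psumD p r : psum p -> psum r -> psum (p + r).
Proof.
by case=> s -> [t ->]; exists (s ++ t); rewrite big_cat size_cat PoszD.
Qed.

Lemma psum_mon x : mon x -> psum (x, 1).
Proof. by case=> m ->; exists [:: m]; rewrite big_seq1. Qed.

Lemma psum1 : psum 1.
Proof. by apply: psum_mon; move: (mon_scal 0); rewrite scale1r. Qed.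

Lemma psumM p r : psum p -> psum r -> psum (p * r).
Proof.
case=> s -> [t ->]; elim: s => [|m s IH].
  by rewrite big_nil mul0r; apply: psum0.
have -> : (\sum_(m <- m :: s) qmonom_val q m, (size (m :: s))%:Z) =
    (qmonom_val q m, 1) + (\sum_(m <- s) qmonom_val q m, (size s)%:Z)
    :> A * int.
  by rewrite big_cons.
rewrite mulrDl; apply: psumD IH; elim: t => [|n t IH].
  by rewrite big_nil mulr0; apply: psum0.
have -> : (\sum_(m <- n :: t) qmonom_val q m, (size (n :: t))%:Z) =
    (qmonom_val q n, 1) + (\sum_(m <- t) qmonom_val q m, (size t)%:Z)
    :> A * int.
  by rewrite big_cons.
rewrite mulrDr; apply: psumD IH.
by apply: psum_mon; apply: monM; eexists.
Qed.

(** * The given matrices paired with their integer counterparts *)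

Variable upper : 'I_k -> bool.

Definition pairmx i : 'M[(A * int)%type]_2 :=
  \matrix_(j, l) (Amx q upper i j l, A0mx upper i j l).

Lemma psum_pairmx i (j l : 'I_2) : psum (pairmx i j l).
Proof.
have [/mon_lmon ma /mon_lmon mA /mon_lmon mb] := lmon_gen i.
rewrite mxE /Amx /A0mx; case: (upper i); rewrite !mxE;
  by case: (j == 0); case: (l == 0); try exact: psum_mon; exact: psum0.
Qed.

Let u : A * int := (q%:A, 1).
Let v : A * int := (q^-1%:A, 1).

Let uC p : u * p = p * u.
Proof.
by rewrite /u /GRing.mul /= /mul_pair /= mulr_algl mulr_algr mul1r mulr1.
Qed.

Let uv1 : u * v = 1.
Proof.
rewrite /u /v /GRing.mul /= /mul_pair /= mulr_algl scalerA divff // scale1r.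
by rewrite mulr1.
Qed.

Lemma mxcomm_pairmx i j : i != j -> mxcomm (pairmx i) (pairmx j).
Proof.
move=> ij i1 i2 j1 j2; rewrite !mxE.
suff c : GRing.comm (Amx q upper i i1 i2) (Amx q upper j j1 j2).
  by rewrite /GRing.comm; congr (_, _); [exact: c | exact: mulrC].
have lA l l1 l2 : Amx q upper l l1 l2 = 0 \/ lmon l (Amx q upper l l1 l2).
  have [ma mA mb] := lmon_gen l.
  by rewrite /Amx; case: (upper l); rewrite !mxE;
    case: (l1 == 0); case: (l2 == 0); auto.
have c0 x y : x = 0 \/ lmon i x -> y = 0 \/ lmon j y -> GRing.comm x y.
  case=> [->|mx]; first by move=> _; apply/commr_sym/commr0.
  by case=> [->|my]; [apply: commr0 | apply: (lmon_comm ij)].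
exact: c0 (lA i i1 i2) (lA j j1 j2).
Qed.

Lemma qsl2_pairmx i : qsl2 v (pairmx i).
Proof.
apply/(qsl2P uC uv1); rewrite /pairmx /Amx /A0mx.
case: (upper i); rewrite !mxE /=; split;
  rewrite /u /v /GRing.mul /= /mul_pair /=;
  congr (_, _) => //=.
- by rewrite mulr0 mul0r mulr0.
- by rewrite gb_gaV mulr_algl scalerA divff // scale1r.
- by rewrite mul0r mulr0 addr0 ga_gaV.
- by rewrite mulr0 mulr0 addr0 gaV_ga.
- by rewrite gb_ga mulr_algl.
- by rewrite mulr0 mul0r mulr0.
- by rewrite mulr0 mulr0 addr0 ga_gaV.
- by rewrite mul0r mulr0 addr0 gaV_ga.
Qed.

(** Both values are projections of a single Chebyshev value over A * int, since the projections are
    ring morphisms. *)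
Lemma psum_cheb n :
  psum (cheb_eval n (\tr (\prod_(i < k) Amx q upper i)),
        (chebT n).[\tr (\prod_(i < k) A0mx upper i)]).
Proof.
have -> : \prod_(i < k) Amx q upper i = map_mx fst (\prod_(i < k) pairmx i).
  rewrite (rmorph_prod (map_mx fst)); apply: eq_bigr => i _.
  by apply/matrixP => j l; rewrite !mxE.
have -> : \prod_(i < k) A0mx upper i = map_mx snd (\prod_(i < k) pairmx i).
  rewrite (rmorph_prod (map_mx snd)); apply: eq_bigr => i _.
  by apply/matrixP => j l; rewrite !mxE.
rewrite !trace_map_mx -cheb_evalE -!cheb_eval_morph -surjective_pairing.
apply: (cheb_eval_tr_prod_pos uC uv1 psum0 psum1 psumD psumM).
- by apply: psum_mon; apply: (mon_scal 1).
- by apply: psum_mon; apply: (mon_scal (-1)).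
- exact: mxcomm_pairmx.
- exact: qsl2_pairmx.
- exact: psum_pairmx.
Qed.

End Monomials.

(** * Uniqueness of the number of terms *)

Section ShiftAction.
Variables (K : fieldType) (q : K) (k : nat).
Hypothesis q0 : q != 0.
Local Notation A := (qalg q k).
Local Notation F := (freealg K (letter k)).
Local Notation pt := {ffun 'I_k -> int}.
Implicit Types (f g : pt -> K) (p : pt) (x y : F).

Definition unit_pt i : pt := [ffun j => (j == i)%:Z].

Definition letter_act (l : letter k) f p : K :=
  match l with
  | inl (inl i) => f (p + unit_pt i)
  | inl (inr i) => f (p - unit_pt i)
  | inr i => q ^ (- p i) * f p
  end.

Definition word_act (w : seq (letter k)) f : pt -> K := foldr letter_act f w.

(** Such operators are linear, stable under composition, and send the constant 1 to a function whose
    values are powers of q. *)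
Definition weighted_shift (T : (pt -> K) -> pt -> K) :=
  exists (c : pt -> int) (e : pt), forall f p, T f p = q ^ c p * f (p + e).

Lemma weighted_shift_id T : (forall f p, T f p = f p) -> weighted_shift T.
Proof.
by move=> TE; exists (fun=> 0), 0 => f p; rewrite TE expr0z mul1r addr0.
Qed.

Lemma weighted_shift_comp T1 T2 T : weighted_shift T1 -> weighted_shift T2 ->
  (forall f p, T f p = T1 (T2 f) p) -> weighted_shift T.
Proof.
move=> [c1 [e1 E1]] [c2 [e2 E2]] TE.
exists (fun p => c1 p + c2 (p + e1)), (e1 + e2) => f p.
by rewrite TE E1 E2 mulrA -expfzDr // addrA.
Qed.

Lemma weighted_shift_letter l : weighted_shift (letter_act l).
Proof.
case: l => [[i|i]|i] /=.
- by exists (fun=> 0), (unit_pt i) => f p; rewrite expr0z mul1r.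
- by exists (fun=> 0), (- unit_pt i) => f p; rewrite expr0z mul1r.
- by exists (fun p => - p i), 0 => f p; rewrite addr0.
Qed.

Lemma weighted_shift_word w : weighted_shift (word_act w).
Proof.
elim: w => [|l w IH]; first exact: weighted_shift_id.
exact: weighted_shift_comp (weighted_shift_letter l) IH _.
Qed.

Definition act x f p :=
  mmap idfun (fun m : {fmonom letter k} => word_act m f p) x.

(** Words act linearly, being weighted shifts, so the action of a word of x enters the sum over the
    words of y. *)
Lemma actM x y f p : act (x * y) f p = act x (act y f) p.
Proof.
rewrite /act (malgME x y) raddf_sum [RHS]mmapE; apply: eq_bigr => m1 _.
have [c [e E]] := weighted_shift_word m1.
rewrite raddf_sum /= E mmapE !mulr_sumr; apply: eq_bigr => m2 _.
rewrite mmapU /= fmM /word_act foldr_cat -/(word_act m1 _) E -!mulrA.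
by congr (_ * _); rewrite mulrCA.
Qed.

Lemma actB x y f p : act (x - y) f p = act x f p - act y f p.
Proof. exact: mmapB. Qed.

Lemma actD x y f p : act (x + y) f p = act x f p + act y f p.
Proof. exact: mmapD. Qed.

Lemma actZ c x f p : act (c *: x) f p = c * act x f p.
Proof.
rewrite /act (mmapEw (msuppZ_le c x)) mmapE mulr_sumr.
by apply: eq_bigr => m _; rewrite mcoeffZ mulrA.
Qed.

Lemma act_gen l f p : act (fgen K l) f p = letter_act l f p.
Proof. by rewrite /act /fgen mmapU mul1r fmU. Qed.

Lemma act1 f p : act 1 f p = f p.
Proof.
have -> : (1 : F) = mkmalgU (fmone (letter k)) (1 : K) by [].
by rewrite /act mmapU mul1r fmoneE.
Qed.

Lemma act_eq0 x f : (forall p, f p = 0) -> forall p, act x f p = 0.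
Proof.
move=> f0 p; rewrite /act mmapE big1 // => m _.
by have [c [e ->]] := weighted_shift_word m; rewrite f0 !mulr0.
Qed.

Lemma act_gen2 l1 l2 f p :
  act (fgen K l1 * fgen K l2) f p = letter_act l1 (letter_act l2 f) p.
Proof.
by rewrite actM act_gen; case: l1 => [[i|i]|i]; rewrite /letter_act act_gen.
Qed.

Lemma act_sub_eq0 x y f p c d :
  act x f p = c -> act y f p = d -> c = d -> act (x - y) f p = 0.
Proof. by rewrite actB => -> -> ->; rewrite subrr. Qed.

Lemma act_relator r : relator q r -> forall f p, act r f p = 0.
Proof.
pose a (i : 'I_k) : letter k := inl (inl i).
pose aV (i : 'I_k) : letter k := inl (inr i).
pose b (i : 'I_k) : letter k := inr i.
case=> [i|i|i|i j ij|i j ij|i j ij] f p; have g2 l1 l2 := act_gen2 l1 l2 f p.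
- by apply: act_sub_eq0 (g2 (a i) (aV i)) (act1 f p) _; rewrite /= addrK.
- by apply: act_sub_eq0 (g2 (aV i) (a i)) (act1 f p) _; rewrite /= subrK.
- have e := etrans (actZ q _ f p) (congr1 _ (g2 (a i) (b i))).
  apply: act_sub_eq0 (g2 (b i) (a i)) e _.
  (* The shift by e_i lowers the exponent - p_i by one, which the factor q restores. *)
  rewrite /= !ffunE eqxx mulrA opprD (expfzDr _ _ q0) exprN1.
  by rewrite [q * _]mulrCA mulfV // mulr1.
- by apply: act_sub_eq0 (g2 (a i) (a j)) (g2 (a j) (a i)) _; rewrite /= addrAC.
- apply: act_sub_eq0 (g2 (a i) (b j)) (g2 (b j) (a i)) _.
  by rewrite /= !ffunE (eq_sym j) (negPf ij) addr0.
- by apply: act_sub_eq0 (g2 (b i) (b j)) (g2 (b j) (b i)) _; rewrite /= mulrCA.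
Qed.

Lemma act_ideal x : gen_ideal (@relator K q k) x -> forall f p, act x f p = 0.
Proof.
elim=> [|u r v y Sr _ IH] f p; first exact: mmap0.
by rewrite actD IH addr0 !actM act_eq0 //; apply: act_relator.
Qed.

(** By [qact_proj] the action does not depend on the representative. *)
Definition qact (a : A) f p := act (repr a) f p.

Lemma qact_proj x f p : qact (quot_proj (@relator K q k) x) f p = act x f p.
Proof.
by apply/eqP; rewrite -subr_eq0 -actB act_ideal //; apply: repr_quot_proj.
Qed.

Lemma qactM a b f p : qact (a * b) f p = qact a (qact b f) p.
Proof.
rewrite -[a in LHS]quot_projK -[b in LHS]quot_projK.
by rewrite -[_ * _]quot_projM qact_proj actM.
Qed.

Lemma qactD a b f p : qact (a + b) f p = qact a f p + qact b f p.
Proof.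
rewrite -[a in LHS]quot_projK -[b in LHS]quot_projK.
by rewrite -[_ + _]quot_projD qact_proj actD.
Qed.

Lemma qactZ c a f p : qact (c *: a) f p = c * qact a f p.
Proof.
by rewrite -[a in LHS]quot_projK -[_ *: _]quot_projZ qact_proj actZ.
Qed.

Lemma qact1 f p : qact 1 f p = f p.
Proof. by rewrite -[1]quot_proj1 qact_proj act1. Qed.

Lemma qact0 f p : qact 0 f p = 0.
Proof. by rewrite -[0]quot_proj0 qact_proj /act mmap0. Qed.

Lemma weighted_shift_qmonom (m : qmonom k) :
  weighted_shift (qact (qmonom_val q m)).
Proof.
have wM a b : weighted_shift (qact a) -> weighted_shift (qact b) ->
    weighted_shift (qact (a * b)).
  by move=> wa wb; apply: (weighted_shift_comp wa wb) => f p; apply: qactM.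
have w1 : weighted_shift (qact 1).
  by apply: weighted_shift_id => f p; apply: qact1.
have wX a n : weighted_shift (qact a) -> weighted_shift (qact (a ^+ n)).
  by move=> wa; elim: n => [|n IH] //; rewrite exprS; apply: wM.
have wgen l : weighted_shift (qact (quot_proj (@relator K q k) (fgen K l))).
  have [c [e E]] := weighted_shift_letter l.
  by exists c, e => f p; rewrite qact_proj act_gen E.
suff [c [e E]] : weighted_shift (qact
    (\prod_(i < k) (ga_exp q i (qm_alpha m i) * gb q i ^+ qm_beta m i))).
  exists (fun p => qm_xi m + c p), e => f p.
  by rewrite qactZ E mulrA -expfzDr.
elim/big_rec: _ => [//|i a _ wa]; apply: (wM _ _ _ wa); apply: wM;
  last exact/wX/wgen.
by case: (qm_alpha m i) => n; apply/wX/wgen.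
Qed.

Lemma qact_sum_qmonom (s : seq (qmonom k)) : exists t : seq int,
  size t = size s /\
  qact (\sum_(m <- s) qmonom_val q m) (fun=> 1) 0 = \sum_(z <- t) q ^ z.
Proof.
elim: s => [|m s [t [st tE]]]; first by exists [::]; rewrite !big_nil qact0.
have [c [e E]] := weighted_shift_qmonom m.
exists (c 0 :: t); split; first by rewrite /= st.
by rewrite !big_cons qactD tE E mulr1.
Qed.

End ShiftAction.

(** * Transcendence, the closed form and the theorem *)

Lemma transcendental_neq0 (R : realType) (q : R[i]) :
  transcendental q -> q != 0.
Proof.
move=> tq; apply/eqP => q0; apply: tq; exists 'X; first by rewrite polyX_eq0.
by rewrite map_polyX q0 /root hornerX.
Qed.

(** Multiplied by a power of q, the sums become values at q of two rational polynomials, which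
    coincide by transcendence; their value at 1 counts the terms. *)
Lemma transcendental_sum_expz (R : realType) (q : R[i]) (s t : seq int) :
  transcendental q ->
  \sum_(z <- s) q ^ z = \sum_(z <- t) q ^ z -> size s = size t.
Proof.
move=> tq st; have q0 := transcendental_neq0 tq.
(* N bounds every exponent in absolute value, so z + N is nonnegative throughout both lists. *)
pose N := (\sum_(z <- s ++ t) `|z|)%N.
pose P (r : seq int) : {poly rat} := \sum_(z <- r) 'X^(absz (z + N%:Z)).
have PE r : {subset r <= s ++ t} ->
    (map_poly ratr (P r)).[q] = q ^+ N * \sum_(z <- r) q ^ z.
  move=> rst; rewrite rmorph_sum horner_sum mulr_sumr.
  apply: eq_big_seq => z /rst zst; rewrite /= map_polyXn hornerXn.
  rewrite (exprnP q N) -expfzDr // [LHS]exprnP; congr (_ ^ _).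
  have : (`|z| <= N)%N by rewrite /N (big_rem z) //= leq_addr.
  lia.
have P1 r : (P r).[1] = (size r)%:R.
  rewrite horner_sum -sum1_size natr_sum; apply: eq_bigr => z _.
  by rewrite hornerXn expr1n.
have [/(congr1 (fun p : {poly rat} => p.[1]))|Pst] := eqVneq (P s) (P t).
  by rewrite !P1 => /eqP; rewrite eqr_nat => /eqP.
case: tq; exists (P s - P t); first by rewrite subr_eq0.
rewrite /root rmorphB hornerD hornerN !PE ?st ?subrr //.
  by move=> z zt; rewrite mem_cat zt orbT.
by move=> z zs; rewrite mem_cat zs.
Qed.

(** Left multiplication by a factor keeps the entries nonnegative and the diagonal ones at least 1.
    The bound 2 makes t_0^2 - 4 nonnegative, so [Num.sqrt] is a true square root there. *)
Lemma A0mx_trace_ge2 k (upper : 'I_k -> bool) :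
  2 <= \tr (\prod_(i < k) A0mx upper i).
Proof.
set M := \prod_(i < k) _.
suff [p00 p11 _ _] : [/\ 1 <= M 0 0, 1 <= M 1 1, 0 <= M 0 1 & 0 <= M 1 0].
  by rewrite mxtrace2; apply: (lerD p00 p11).
rewrite /M; elim/big_rec: _ => [|i N _]; first by rewrite !mxE.
have ME a b :
    (A0mx upper i * N) a b =
    A0mx upper i a 0 * N 0 b + A0mx upper i a 1 * N 1 b.
  rewrite mxE !big_ord_recl big_ord0 addr0.
  by have -> : lift ord0 ord0 = 1 :> 'I_2 by apply: val_inj.
rewrite !ME; move: (N 0 0) (N 0 1) (N 1 0) (N 1 1).
move=> n00 n01 n10 n11 [h1 h2 h3 h4].
by rewrite /A0mx; case: (upper i); rewrite !mxE /= !mul1r ?mul0r; split; lia.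
Qed.

(** The two bases have sum t and product 1, so their power sums satisfy the Chebyshev recurrence. *)
Lemma chebT_closed_form (R : rcfType) (t : int) n : 2 <= t ->
  (chebT n).[t]%:~R =
    ((t%:~R + Num.sqrt (t%:~R ^+ 2 - 4%:R)) / 2%:R) ^+ n
    + ((t%:~R - Num.sqrt (t%:~R ^+ 2 - 4%:R)) / 2%:R) ^+ n :> R.
Proof.
move=> t2; set x : R := t%:~R; set d := Num.sqrt _.
have d2 : d ^+ 2 = x ^+ 2 - 4%:R.
  apply: sqr_sqrtr; rewrite subr_ge0 (_ : 4%:R = 2%:R ^+ 2); last first.
    by rewrite -natrX.
  have x2 : 2%:R <= x by rewrite -[2%:R]/(2%:~R) ler_int.
  by rewrite ler_sqr // nnegrE ?(le_trans _ x2) ?ler0n.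
set a := (x + d) / 2%:R; set b := (x - d) / 2%:R.
have two0 : 2%:R != 0 :> R by rewrite pnatr_eq0.
have ab : a + b = x by rewrite /a /b; field.
have ab1 : a * b = 1.
  by rewrite /a /b mulrACA [(x + d) * _]mulrC -subr_sqr d2; field.
suff [] : (chebT n).[t]%:~R = a ^+ n + b ^+ n /\
  (chebT n.+1).[t]%:~R = a ^+ n.+1 + b ^+ n.+1 by [].
elim: n => [|n [IH0 IH1]].
  by rewrite -!cheb_evalE cheb_eval0 cheb_eval1 !expr1 ab.
split=> //; rewrite -cheb_evalE cheb_evalSS !cheb_evalE intrB intrM IH0 IH1.
rewrite -/x -ab !exprS.
by rewrite -[X in _ - X]mul1r -ab1; ring.
Qed.

Theorem proposition22 (R : realType) (q : R[i]) (hq : transcendental q)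
    (k : nat) (upper : 'I_k -> bool) :
  let t0 : int := \tr (\prod_(i < k) A0mx upper i) in
  let t : R := t0%:~R in
  0 < t0 /\
  forall n : nat,
    (chebT n).[t0]%:~R = ((t + Num.sqrt (t ^+ 2 - 4%:R)) / 2%:R) ^+ n
                       + ((t - Num.sqrt (t ^+ 2 - 4%:R)) / 2%:R) ^+ n /\
    sum_of_exactly (chebT n).[t0]
      (cheb_eval n (\tr (\prod_(i < k) Amx q upper i))).
Proof.
move=> t0 t; have t2 : 2 <= t0 := A0mx_trace_ge2 upper.
split=> [|n]; first exact: lt_le_trans t2.
split; first exact: chebT_closed_form.
have q0 := transcendental_neq0 hq.
have [s [sE sN]] := psum_cheb q0 upper n.
split=> [|s' s'E]; first by exists s.
rewrite sN; congr Posz.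
(* Acting on 1 and evaluating at 0 turns the two lists into sums of powers of q with equal
   values. *)
have [z [<- zE]] := qact_sum_qmonom q0 s.
have [z' [<- z'E]] := qact_sum_qmonom q0 s'.
by apply: (transcendental_sum_expz hq); rewrite -zE -z'E -sE -s'E.
Qed.
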